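(* Let $G$ be a group. Then: (i) $E(\mathrm{Com}(G)) \subseteq E(\mathrm{SNorm}(G)) \subseteq E(\mathrm{Nilp}(G))$. (ii) $E(\mathrm{SNorm}(G)) \subseteq E(\mathrm{NGen}(G))$ if $G$ is a non-abelian simple group or $G$ is not $2$-generated. (iii) $E(\mathrm{SNorm}(G)) \subseteq E(\mathrm{Engel}(G))$.
   Context: All graphs are simple undirected graphs with vertex set $G$ (the set of elements of the group), and $E(\Gamma)$ denotes the edge set of a graph $\Gamma$. For a subgroup $H$ of $G$, $N(H)$ is the normaliser of $H$ in $G$. The commutator is $[x,y]=xyx^{-1}y^{-1}$, and $[x,_1 y]=[x,y]$, $[x,_k y]=[[x,_{k-1}y],y]$ for $k\ge 2$. For distinct $x,y\in G$: - $x,y$ are adjacent in the commuting graph $\mathrm{Com}(G)$ iff $xy=yx$; - $x,y$ are adjacent in the symmetric normaliser graph $\mathrm{SNorm}(G)$ iff $x\in N(\langle y\rangle)$ and $y\in N(\langle x\rangle)$; - $x,y$ are adjacent in the nilpotent graph $\mathrm{Nilp}(G)$ iff $\langle x,y\rangle$ is nilpotent; - $x,y$ are adjacent in the non-generating graph $\mathrm{NGen}(G)$ iff $\langle x,y\rangle\neq G$; - $x,y$ are adjacent in the Engel graph $\mathrm{Engel}(G)$ iff for some positive integer $k$ either $[x,_k y]=1$ or $[y,_k x]=1$. A group is $2$-generated if it can be generated by two elements. *)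

(* Defs.v *)
(* [groupType] is an arbitrary, possibly infinite, group; its subsets are the
   sets of classical_sets, not finsets. *)
From HB Require Import structures.
From mathcomp Require Import all_boot.
From mathcomp Require Import boolp classical_sets.

Set Implicit Arguments.
Unset Strict Implicit.
Unset Printing Implicit Defensive.

Local Open Scope classical_set_scope.
Local Open Scope group_scope.

Record sgraph (V : Type) := SGraph {
  adj : V -> V -> Prop;
  adj_irrefl : forall x, ~ adj x x;
  adj_sym : forall x y, adj x y -> adj y x }.

Definition edges (V : Type) (Gamma : sgraph V) : set (set V) :=
  [set e | exists x y, adj Gamma x y /\ e = [set x; y]].

Section Groups.
Variable G : groupType.
Implicit Types (x y g : G) (A H K N : set G).

Definition subgroup H : Prop := group_closed (mem H).

Definition gen A : set G := smallest subgroup A.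

(* Equality, not inclusion: the two differ in infinite groups. *)
Definition normaliser H : set G := [set g | [set h ^ g | h in H] = H].

(* The library's [~ x, y] is x^-1 * y^-1 * x * y. *)
Definition comm x y : G := x * y * x^-1 * y^-1.

(* [x,_k y]; the value at k = 0 is x. *)
Definition iter_comm x (k : nat) y : G := iter k (fun z => comm z y) x.

Definition comm_subgroup H K : set G :=
  gen [set comm h k | h in H & k in K].

(* Term n is usually written gamma_(n+1)(H). *)
Definition lower_central H (n : nat) : set G :=
  iter n (fun K => comm_subgroup K H) H.

Definition nilpotent_subgroup H : Prop :=
  exists n, lower_central H n = [set 1].

Definition abelian_group : Prop := forall x y, commute x y.

Definition simple_group : Prop :=
  [set: G] <> [set 1] /\
  forall N, subgroup N -> normaliser N = [set: G] ->
    N = [set 1] \/ N = [set: G].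

Definition two_generated : Prop := exists x y, gen [set x; y] = [set: G].

Definition com_adj x y := x <> y /\ commute x y.

Definition snorm_adj x y :=
  x <> y /\ normaliser (gen [set y]) x /\ normaliser (gen [set x]) y.

Definition nilp_adj x y := x <> y /\ nilpotent_subgroup (gen [set x; y]).

Definition ngen_adj x y := x <> y /\ gen [set x; y] <> [set: G].

Definition engel_adj x y :=
  x <> y /\
  exists k : nat, (0 < k)%N /\ (iter_comm x k y = 1 \/ iter_comm y k x = 1).

Lemma com_irrefl x : ~ com_adj x x. Proof. by case. Qed.
Lemma snorm_irrefl x : ~ snorm_adj x x. Proof. by case. Qed.
Lemma nilp_irrefl x : ~ nilp_adj x x. Proof. by case. Qed.
Lemma ngen_irrefl x : ~ ngen_adj x x. Proof. by case. Qed.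
Lemma engel_irrefl x : ~ engel_adj x x. Proof. by case. Qed.

Lemma com_sym x y : com_adj x y -> com_adj y x.
Proof. by move=> [/nesym nyx /commute_sym cyx]. Qed.

Lemma snorm_sym x y : snorm_adj x y -> snorm_adj y x.
Proof. by move=> [/nesym nyx [xNy yNx]]. Qed.

Lemma nilp_sym x y : nilp_adj x y -> nilp_adj y x.
Proof. by move=> [/nesym nyx nil]; split=> //; rewrite setUC. Qed.

Lemma ngen_sym x y : ngen_adj x y -> ngen_adj y x.
Proof. by move=> [/nesym nyx ng]; split=> //; rewrite setUC. Qed.

Lemma engel_sym x y : engel_adj x y -> engel_adj y x.
Proof.
by move=> [/nesym nyx [k [k0 xy]]]; split=> //; exists k; split=> //; apply/or_comm.
Qed.

End Groups.

Definition Com (G : groupType) : sgraph G :=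
  SGraph (@com_irrefl G) (@com_sym G).
Definition SNorm (G : groupType) : sgraph G :=
  SGraph (@snorm_irrefl G) (@snorm_sym G).
Definition Nilp (G : groupType) : sgraph G :=
  SGraph (@nilp_irrefl G) (@nilp_sym G).
Definition NGen (G : groupType) : sgraph G :=
  SGraph (@ngen_irrefl G) (@ngen_sym G).
Definition Engel (G : groupType) : sgraph G :=
  SGraph (@engel_irrefl G) (@engel_sym G).

(* Main.v *)
Require Import Defs.
From mathcomp Require Import all_boot.
From mathcomp Require Import boolp classical_sets.

Local Open Scope classical_set_scope.

(** Suppose that [x] normalises [<y>] and [y] normalises [<x>]. Read as
    [(x y x^-1) y^-1], the commutator [x, y] lies in [<y>]; read as
    [x (y x^-1 y^-1)], it lies in [<x>]. It therefore commutes with both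
    generators of [H = <x, y>], so it is central in [H], and then every
    commutator of elements of [H] is central in [H]: the group [H] is nilpotent
    of class at most two ([snorm_central_comm] and [gen_central_comm]).

    The inclusions of [SNorm] follow. The third term of the lower central series
    of [H] is trivial, which gives [Nilp]; [[x, y], y] = 1, which gives [Engel];
    and a simple group of class at most two is abelian, as its centre is trivial
    or everything, so a non-abelian simple group is not [<x, y>], which gives
    [NGen]. If [x] and [y] commute, each centralises, hence normalises, the
    cyclic group generated by the other, which gives [Com] inside [SNorm]. *)

Section Helpers.
Local Open Scope group_scope.
Variable G : groupType.
Implicit Types (x y z g h k a b : G) (A B H : set G).

Lemma subgroupP H :
  subgroup H <-> H 1 /\ (forall a b, H a -> H b -> H (a * b^-1)).
Proof.
split=> -[H1 HD]; split.
- by rewrite inE in H1.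
- by move=> a b Ha Hb; have := HD a b; rewrite !inE; apply.
- by rewrite inE.
- by move=> a b; rewrite !inE; apply: HD.
Qed.

Lemma subgroup1 {H} : subgroup H -> H 1.
Proof. by move=> /subgroupP[]. Qed.

Lemma subgroupV {H a} : subgroup H -> H a -> H a^-1.
Proof. by move=> /subgroupP[H1 HD] Ha; rewrite -[a^-1]mul1g; apply: HD. Qed.

Lemma subgroupM {H a b} : subgroup H -> H a -> H b -> H (a * b).
Proof.
move=> sH Ha /(subgroupV sH) Hb; rewrite -[b]invgK.
by move/subgroupP: sH => [_]; apply.
Qed.

Lemma gen_subgroup A : subgroup (gen A).
Proof.
apply/subgroupP; split=> [K [/subgroupP[]//]|a b ga gb K KA].
have [/subgroupP[_ KD] _] := KA.
by apply: KD; [apply: ga | apply: gb].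
Qed.

Definition centraliser A : set G := [set z | forall a, A a -> commute z a].

Lemma centraliser_subgroup A : subgroup (centraliser A).
Proof.
apply/subgroupP; split=> [a _|a b Ca Cb c Ac]; first exact/commute_sym/commute1.
apply/commute_sym/commuteM; first exact/commute_sym/Ca.
exact/commuteV/commute_sym/Cb.
Qed.

(** The elements commuting with a given [z] form a subgroup, so [z] need only
    be tested against generators. *)
Lemma centraliser_gen A : centraliser (gen A) = centraliser A.
Proof.
apply/seteqP; split=> z Cz a; first by move=> Aa; apply: Cz; apply: sub_gen_smallest.
suff /[apply] : gen A `<=` centraliser [set z].
  by move=> /(_ z erefl)/commute_sym.
apply: smallest_sub; first exact: centraliser_subgroup.
by move=> b Ab _ ->; apply/commute_sym/Cz.
Qed.

Lemma centraliser_normaliser {H z} : centraliser H z -> normaliser H z.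
Proof.
move=> Cz.
have fixH h : H h -> h ^ z = h by move=> Hh; rewrite conjgE -(Cz h Hh) mulKg.
by apply/seteqP; split=> [_ [h Hh <-]|h Hh]; [rewrite fixH | exists h; rewrite ?fixH].
Qed.

Definition central_comm H : Prop :=
  forall h k, H h -> H k -> centraliser H (comm h k).

Lemma commV h k : comm k h = (comm h k)^-1.
Proof. by rewrite /comm !invgM !invgK !mulgA. Qed.

Lemma comm1 h k : comm h k = 1 <-> commute h k.
Proof.
rewrite /comm /commute; split=> [|->]; last by rewrite !mulgK mulgV.
by move/(congr1 (fun t => t * k * h)); rewrite !mulgVK mul1g.
Qed.

(** When [[a, k]] and [[b, k]] commute with all of [H], the commutator with [k]
    is multiplicative on [a] and [b]: [[ab^-1, k] = [b, k]^-1 [a, k]]. *)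
Lemma central_comm_subgroup {H} k : subgroup H ->
  subgroup [set h | H h /\ centraliser H (comm h k)].
Proof.
move=> sH; have [H1 HD] := (subgroupP H).1 sH.
have sC := centraliser_subgroup H.
apply/subgroupP; split=> [|a b [Ha Ca] [Hb Cb]]; split=> //.
- rewrite (comm1 1 k).2; last exact/commute_sym/commute1.
  exact: subgroup1 sC.
- exact: HD.
(* The commutator expands to [(ab^-1) [b, k]^-1 (ab^-1)^-1 [a, k]], and
   [ab^-1] lies in [H], so it commutes with [[b, k]^-1]. *)
- have -> : comm (a * b^-1) k = (comm b k)^-1 * comm a k.
    have /(_ _ (HD a b Ha Hb)) cab := subgroupV sC Cb.
    rewrite -[LHS](mulgK (comm a k)^-1) invgK; congr (_ * _).
    rewrite -[RHS](mulgK (a * b^-1)) cab -commV /comm.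
    by rewrite !invgM !invgK !mulgA !mulgVK.
  exact: subgroupM sC (subgroupV sC Cb) Ca.
Qed.

(** Centrality of commutators passes from the generators to the whole subgroup,
    one argument at a time. *)
Lemma gen_central_comm {A} :
  (forall a b, A a -> A b -> centraliser A (comm a b)) -> central_comm (gen A).
Proof.
move=> CA; have sH := gen_subgroup A.
have extend k : (forall a, A a -> centraliser A (comm a k)) ->
    forall h, gen A h -> centraliser (gen A) (comm h k).
  move=> Ck h.
  suff /[apply] : gen A `<=`
      [set h | gen A h /\ centraliser (gen A) (comm h k)] by case.
  apply: smallest_sub; first exact: central_comm_subgroup.
  move=> a Aa; split; first exact: sub_gen_smallest.
  by rewrite centraliser_gen; apply: Ck.
move=> h k Hh Hk; apply: (extend k) => // a Aa; rewrite -centraliser_gen commV.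
apply: (subgroupV (centraliser_subgroup _)).
by apply: (extend a) => // b Ab; apply: CA.
Qed.

Lemma central_comm_nilpotent {H} : central_comm H -> nilpotent_subgroup H.
Proof.
move=> CH; exists 2%N; rewrite /lower_central /= /comm_subgroup.
set D := gen [set comm h k | h in H & k in H].
have DC : D `<=` centraliser H.
  apply: smallest_sub; first exact: centraliser_subgroup.
  by move=> _ [h Hh [k Hk <-]]; apply: CH.
apply/seteqP; split=> [|_ ->]; last exact: (subgroup1 (gen_subgroup _)).
apply: smallest_sub.
  by apply/subgroupP; split=> // _ _ -> ->; rewrite /= mulgV.
by move=> _ [z Dz [h Hh <-]]; apply/comm1/DC.
Qed.

(** The centre of a simple group is trivial or everything; in class at most two
    the first case makes all commutators trivial. *)
Lemma simple_central_comm_abelian :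
  simple_group G -> central_comm [set: G] -> abelian_group G.
Proof.
move=> [_ simG] CG.
have [|Z1|ZT] := simG _ (centraliser_subgroup [set: G]).
- apply/seteqP; split=> // g _; apply: centraliser_normaliser => z Cz.
  exact/commute_sym/Cz.
- by move=> x y; apply/comm1; have := CG x y I I; rewrite Z1.
- move=> x y; suff: centraliser [set: G] x by apply.
  by rewrite ZT.
Qed.

Lemma gen1_centraliser {y h} : gen [set y] h -> commute h y.
Proof.
move=> /[dup] yh; suff /[apply] : gen [set y] `<=` centraliser [set y] by apply.
by apply: smallest_sub; [apply: centraliser_subgroup | move=> _ -> _ ->].
Qed.

(** The equality in the definition of the normaliser matters here: it gives
    conjugation by [x^-1] as well as by [x]. *)
Lemma normaliser_comm {x y} :
  normaliser (gen [set y]) x -> gen [set y] (comm x y).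
Proof.
move=> Nx; have gy : gen [set y] y by exact: sub_gen_smallest.
have [h gh hxy] : [set h ^ x | h in gen [set y]] y by rewrite Nx.
have -> : comm x y = h * y^-1.
  by rewrite /comm -{1}hxy conjgE !mulgA mulgV mul1g mulgK.
by case/subgroupP: (gen_subgroup [set y]) => _; apply.
Qed.

Lemma snorm_central_comm {x y} : snorm_adj x y ->
  commute (comm x y) x /\ commute (comm x y) y.
Proof.
move=> [_ [Nx Ny]]; split; apply: gen1_centraliser; last exact: normaliser_comm.
rewrite commV; apply: (subgroupV (gen_subgroup _)).
exact: normaliser_comm.
Qed.

Lemma snorm_gen_central_comm {x y} :
  snorm_adj x y -> central_comm (gen [set x; y]).
Proof.
move=> /snorm_central_comm[cx cy]; apply: gen_central_comm.
have sC := centraliser_subgroup [set x; y].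
have C1 a : centraliser [set x; y] (comm a a).
  by rewrite (comm1 a a).2 //; apply: subgroup1 sC.
have Cxy : centraliser [set x; y] (comm x y) by move=> _ [->|->].
move=> _ _ [->|->] [->|->] //.
by rewrite commV; apply: subgroupV sC Cxy.
Qed.

Lemma com_snorm {x y} : com_adj x y -> snorm_adj x y.
Proof.
move=> [nxy cxy]; split=> //.
by split; apply: centraliser_normaliser; rewrite centraliser_gen => _ ->.
Qed.

Lemma snorm_nilp {x y} : snorm_adj x y -> nilp_adj x y.
Proof.
move=> sxy; split; first by case: sxy.
exact/central_comm_nilpotent/snorm_gen_central_comm.
Qed.

Lemma snorm_ngen {x y} :
  (simple_group G /\ ~ abelian_group G) \/ ~ two_generated G ->
  snorm_adj x y -> ngen_adj x y.
Proof.
move=> hG sxy; split=> [|gT]; first by case: sxy.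
case: hG => [[simG nabG]|n2G]; last by apply: n2G; exists x, y.
apply/nabG/simple_central_comm_abelian => //.
by rewrite -gT; apply: snorm_gen_central_comm.
Qed.

Lemma snorm_engel {x y} : snorm_adj x y -> engel_adj x y.
Proof.
move=> sxy; split; first by case: sxy.
exists 2%N; split=> //; left.
by apply/comm1; case: (snorm_central_comm sxy).
Qed.

End Helpers.

Lemma sub_edges {V : Type} {Gamma Delta : sgraph V} :
  (forall x y, adj Gamma x y -> adj Delta x y) ->
  edges Gamma `<=` edges Delta.
Proof. by move=> sub _ [x [y [/sub xy ->]]]; exists x, y. Qed.

Theorem theorem1 (G : groupType) :
  (edges (Com G) `<=` edges (SNorm G) /\
   edges (SNorm G) `<=` edges (Nilp G)) /\
  ((simple_group G /\ ~ abelian_group G) \/ ~ two_generated G ->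
   edges (SNorm G) `<=` edges (NGen G)) /\
  edges (SNorm G) `<=` edges (Engel G).
Proof.
split; first by split; apply: sub_edges => x y; [apply: com_snorm | apply: snorm_nilp].
split=> [hG|]; apply: sub_edges => x y; last exact: snorm_engel.
exact: snorm_ngen.
Qed.
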